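(* Let $Y$ be a nonnegative random variable with mean $\mu$ and variance $\sigma^2$, both finite and positive. Suppose there exists a coupling of $Y$ to a random variable $Y^s$ having the $Y$-size bias distribution (that is, $Y^s$ is defined on the same probability space as $Y$) which satisfies $|Y^s-Y|\le C$ with probability one, for some constant $C>0$. (i) If $Y^s\ge Y$ with probability one, then $$P\left(\frac{Y-\mu}{\sigma}\le -t\right)\le \exp\left(-\frac{t^2}{2A}\right)\quad\text{for all } t>0,\quad\text{where } A=\frac{C\mu}{\sigma^2}.$$ (ii) If the moment generating function $m(\theta)=E(e^{\theta Y})$ is finite at $\theta=2/C$, then $$P\left(\frac{Y-\mu}{\sigma}\ge t\right)\le \exp\left(-\frac{t^2}{2(A+Bt)}\right)\quad\text{for all } t>0,\quad\text{where } A=\frac{C\mu}{\sigma^2}\text{ and } B=\frac{C}{2\sigma}.$$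
   Context: For a nonnegative random variable $Y$ with finite nonzero mean $\mu$, a random variable $Y^s$ is said to have the $Y$-size bias (or $Y$-size biased) distribution if $$E[Yf(Y)]=\mu E[f(Y^s)]$$ for all functions $f$ for which these expectations exist. Equivalently, if $F$ is the distribution of $Y$, then the distribution $F^s$ of $Y^s$ is given by $dF^s(x)=\frac{x}{\mu}\,dF(x)$. *)

(* Defs.v *)
From HB Require Import structures.
From mathcomp Require Import all_boot all_order all_algebra.
From mathcomp Require Import all_classical all_reals all_analysis.

Set Implicit Arguments.
Unset Strict Implicit.
Unset Printing Implicit Defensive.

Import Order.TTheory GRing.Theory Num.Theory.
Import numFieldNormedType.Exports.

Local Open Scope classical_set_scope.
Local Open Scope ring_scope.

(* Only the law of Ys matters, so Ys may live on its own probability space; a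
   coupling is the case where the two spaces coincide.  An expectation "exists"
   when the variable is integrable; without that guard the Lebesgue integral
   would still take a (possibly conventional) value. *)
Definition size_biased (d d' : measure_display)
    (T : measurableType d) (T' : measurableType d') (R : realType)
    (P : probability T R) (Y : {RV P >-> R})
    (P' : probability T' R) (Ys : {RV P' >-> R}) : Prop :=
  forall f : R -> R, measurable_fun [set: R] f ->
    P.-integrable [set: T] (fun w => (Y w * f (Y w))%:E) ->
    P'.-integrable [set: T'] (fun w => (f (Ys w))%:E) ->
    ('E_P[fun w => (Y w * f (Y w))%R] = 'E_P[Y] * 'E_P'[fun w => f (Ys w)])%E.

(* Main.v *)
Require Import Defs.
From mathcomp Require Import all_boot all_order all_algebra.
From mathcomp Require Import all_classical all_reals all_analysis.
From mathcomp Require Import measurable_realfun ring lra.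
Import Order.TTheory GRing.Theory Num.Theory.
Import numFieldNormedType.Exports.
Local Open Scope classical_set_scope.
Local Open Scope ring_scope.

(* Let m(a) = E e^(aY).  The size bias identity gives
   E[Y e^(aY)] = mu E e^(a Ys), and |Ys - Y| <= C compares the right-hand side
   with m(a): it is at least mu (1 + C a) m(a) when a <= 0 and Ys >= Y, and at
   most mu (1 + C a / 2) / (1 - C a / 2) m(a) when 0 <= a < 2 / C.  This is a
   differential inequality for ln m, which integrates to
   ln m(-x) <= - mu x + mu C x^2 / 2 and
   ln m(x) <= mu x + mu C x^2 / (2 (1 - C x / 2)); Chernoff's bound with the
   optimal x concludes.  Differentiation under the integral sign is avoided: by
   convexity, E[Y e^(aY)] / m(a) is a slope of a supporting line of ln m at a,
   and the resulting finite-difference inequalities are summed over finer and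
   finer subdivisions. *)

(** * Comparison of integrals almost everywhere *)

Lemma ae_le_integrable {d} {T : measurableType d} {R : realType}
    (P : {measure set T -> \bar R}) (f g : T -> R) :
  measurable_fun [set: T] f ->
  {ae P, forall w, `|f w| <= `|g w|} ->
  P.-integrable [set: T] (EFin \o g) -> P.-integrable [set: T] (EFin \o f).
Proof.
move=> mf fg /integrableP[mg gfin]; apply/integrableP; split.
  exact/measurable_EFinP.
apply: le_lt_trans gfin; apply: ae_ge0_le_integral => //.
- by apply: measurableT_comp => //; exact/measurable_EFinP.
- by apply: measurableT_comp.
- by apply: filterS fg => w; rewrite /= lee_fin.
Qed.

Lemma ae_ge0_Rintegral {d} {T : measurableType d} {R : realType}
    (P : {measure set T -> \bar R}) (f : T -> R) :
  measurable_fun [set: T] f -> {ae P, forall w, 0 <= f w} ->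
  0 <= (\int[P]_w f w)%R.
Proof.
move=> mf f0; rewrite /Rintegral (@ae_eq_integral _ _ _ _ _ (fun w => `|f w|%:E))//.
- by apply: Rintegral_ge0 => w _.
- exact/measurable_EFinP.
- by apply/measurable_EFinP; apply: measurableT_comp.
- by apply: filterS f0 => w /= f0 _; rewrite ger0_norm.
Qed.

Lemma ae_le_Rintegral {d} {T : measurableType d} {R : realType}
    (P : {measure set T -> \bar R}) (f g : T -> R) :
  P.-integrable [set: T] (EFin \o f) -> P.-integrable [set: T] (EFin \o g) ->
  {ae P, forall w, f w <= g w} ->
  (\int[P]_w f w <= \int[P]_w g w)%R.
Proof.
move=> intf intg fg; rewrite -subr_ge0 -RintegralB//.
have [mf mg] : measurable_fun [set: T] f /\ measurable_fun [set: T] g.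
  by split; apply/measurable_EFinP; [case/integrableP: intf|case/integrableP: intg].
apply: ae_ge0_Rintegral; first exact: measurable_funB.
by apply: filterS fg => w; rewrite subr_ge0.
Qed.

(** * Two inequalities on the real line *)

(** Telescoping over a uniform subdivision of [0, x] bounds [f x - f 0] by right-endpoint Riemann
    sums of [p + k * s], whose limit is the right-hand side. *)
Lemma riemann_sum_bound {R : realType} (f : R -> R) (p k x : R) : 0 <= x ->
  (forall a b, 0 <= a -> a <= b -> b <= x ->
    f b - f a <= (b - a) * (p + k * b)) ->
  f x - f 0 <= p * x + k * x ^+ 2 / 2.
Proof.
move=> x0 fP.
have sumP n i : (0 < n)%N -> (i <= n)%N ->
    f (i%:R / n%:R * x) - f 0 <=
    p * (i%:R / n%:R * x) + k * (x / n%:R) ^+ 2 * (i%:R * (i%:R + 1)) / 2.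
  move=> n0; have n0' : 0 < n%:R :> R by rewrite ltr0n.
  elim: i => [|i IH] lein; first by rewrite !mul0r subrr mulr0 !mulr0 mul0r addr0.
  have := IH (ltnW lein).
  have /fP : 0 <= i%:R / n%:R * x by rewrite mulr_ge0// divr_ge0.
  move=> /(_ (i.+1%:R / n%:R * x)).
  have -> : i%:R / n%:R * x <= i.+1%:R / n%:R * x.
    by rewrite ler_wpM2r// ler_pM2r ?invr_gt0// ler_nat.
  have -> : i.+1%:R / n%:R * x <= x.
    by rewrite ler_piMl// ler_pdivrMr// mul1r ler_nat.
  move=> /(_ isT isT) H1 H2.
  have := lerD H1 H2; rewrite addrA subrK => /le_trans; apply.
  rewrite -natr1 le_eqVlt; apply/orP; left; apply/eqP.
  by field; rewrite gt_eqF.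
(* The telescoped bound exceeds the integral of [p + k s] by O(1/n). *)
have bndP n : (0 < n)%N ->
    f x - f 0 - (p * x + k * x ^+ 2 / 2) <= (k * x ^+ 2 / 2) / n%:R.
  move=> n0; have n0' : n%:R != 0 :> R by rewrite pnatr_eq0 -lt0n.
  have := sumP n n n0 (leqnn n); rewrite divff// mul1r => H.
  rewrite lerBlDr; apply: (le_trans H); rewrite le_eqVlt; apply/orP; left.
  by apply/eqP; field.
rewrite -subr_le0 leNgt; apply/negP => gap.
set e := (X in 0 < X) in gap; set K := k * x ^+ 2 / 2 in bndP.
have [n n0 /lt_geF] : exists2 n, (0 < n)%N & K / n%:R < e.
  (* [K] may be negative, hence the absolute value; the successor makes [n] positive and strictly
     larger than the quotient. *)
  exists (Num.truncn (`|K| / e)).+1 => //.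
  rewrite ltr_pdivrMr ?ltr0n// mulrC -ltr_pdivrMr//.
  apply: (@le_lt_trans _ _ (`|K| / e)).
    by rewrite ler_pM2r ?invr_gt0// ler_norm.
  by apply: truncnS_gt.
by rewrite bndP.
Qed.

(* This is (e^v - 1) / v <= (e^v + 1) / 2, from the convexity of exp. *)
Lemma expR_pade_le {R : realType} (v : R) : 0 <= v ->
  expR v * (1 - v / 2) <= 1 + v / 2.
Proof.
move=> v0; set w := v / 2; have w0 : 0 <= w by rewrite divr_ge0.
(* [h] vanishes at 0 and is nondecreasing on [0, w]; [0 <= h w] is the claim divided by [expR w]. *)
pose h (x : R) := (1 + x) * expR (- x) - (1 - x) * expR x.
have dh (x : R) : is_derive x 1 h (x * (expR x - expR (- x))).
  apply: is_derive_eq; rewrite /GRing.scale /=; ring.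
have h0 : h 0 <= h w.
  apply: (@ger0_derive1_ndecr _ h 0 w) => // x.
  - rewrite in_itv/= => /andP[x0 _]; rewrite derive1E derive_val.
    rewrite mulr_ge0 1?ltW// subr_gt0 ltr_expR; lra.
  - apply: continuous_subspaceT => y.
    exact/differentiable_continuous/derivable1_diffP.
have : 0 <= h w.
  by apply: le_trans h0; rewrite /h addr0 subr0 oppr0 expR0 mulr1 subrr.
rewrite /h subr_ge0 expRN ler_pdivlMr ?expR_gt0// => H.
have -> : expR v = expR w * expR w by rewrite -expRD /w; congr expR; lra.
by rewrite mulrC mulrA.
Qed.

(** * Convexity of ln m, Chernoff's bound and integration of the differential inequality *)

(* Jensen's inequality for the law tilted by e^(aY): the optimal [c] is
   (b - a) E[Y e^(aY)] / E e^(aY), but a free [c] needs no division. *)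
Lemma mgf_tangent {d} {T : measurableType d} {R : realType}
    {P : probability T R} {Y : T -> R} {a b : R} (c : R) :
  P.-integrable [set: T] (fun w => (expR (a * Y w))%:E) ->
  P.-integrable [set: T] (fun w => (expR (b * Y w))%:E) ->
  P.-integrable [set: T] (fun w => (Y w * expR (a * Y w))%:E) ->
  expR c * ((b - a) * (\int[P]_w (Y w * expR (a * Y w)))%R +
            (1 - c) * (\int[P]_w expR (a * Y w))%R) <=
  (\int[P]_w expR (b * Y w))%R.
Proof.
move=> inta intb intY.
rewrite mulrDr !mulrA -!RintegralZl// -RintegralD//; last 2 first.
- exact: (integrableZl measurableT (expR c * (b - a)) intY).
- exact: (integrableZl measurableT (expR c * (1 - c)) inta).
apply: le_Rintegral => //.
- apply: (integrableD measurableT (integrableZl measurableT (expR c * (b - a)) intY)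
    (integrableZl measurableT (expR c * (1 - c)) inta)).
move=> w _.
(* Pointwise, this is e^u >= 1 + u at u = (b - a) Y - c, weighted by e^(aY + c). *)
have -> : expR (b * Y w) = expR (a * Y w) * expR c * expR ((b - a) * Y w - c).
  by rewrite -!expRD; congr expR; ring.
apply: (@le_trans _ _ (expR (a * Y w) * expR c * (1 + ((b - a) * Y w - c)))).
  by rewrite le_eqVlt; apply/orP; left; apply/eqP; ring.
by rewrite ler_pM2l ?mulr_gt0 ?expR_gt0// expR_ge1Dx.
Qed.

(** The tangent at exponent 0 gives Jensen's bound E e^(aY) >= e^(a E Y), whose right-hand side is
    positive. *)
Lemma mgf_gt0 {d} {T : measurableType d} {R : realType}
    {P : probability T R} {Y : T -> R} {a : R} :
  P.-integrable [set: T] (fun w => (expR (a * Y w))%:E) ->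
  P.-integrable [set: T] (EFin \o Y) ->
  0 < (\int[P]_w expR (a * Y w))%R.
Proof.
move=> inta intY; have exp0 w : expR (0 * Y w) = 1 by rewrite mul0r expR0.
have int0 : (\int[P]_w expR (0 * Y w))%R = 1.
  under eq_Rintegral do rewrite exp0.
  by rewrite Rintegral_cst// mul1r [fine _](congr1 fine (probability_setT P)).
set m := (\int[P]_w (Y w * expR (0 * Y w)))%R.
apply: (lt_le_trans (expR_gt0 (a * m))).
apply: le_trans (@mgf_tangent _ _ _ _ _ 0 _ (a * m) _ inta _).
- by rewrite -/m int0; rewrite subr0 mulr1 addrC subrK mulr1.
- apply: eq_integrable (finite_measure_integrable_cst P 1 measurableT) => //.
  by move=> w _ /=; rewrite exp0.
- by apply: eq_integrable intY => // w _ /=; rewrite exp0 mulr1.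
Qed.

(** For the optimal [c], the factor of [expR c] in [mgf_tangent] collapses to m(a), so that e^c m(a)
    <= m(b). *)
Lemma ln_mgf_tangent {d} {T : measurableType d} {R : realType}
    {P : probability T R} {Y : T -> R} {a b : R} :
  P.-integrable [set: T] (EFin \o Y) ->
  P.-integrable [set: T] (fun w => (expR (a * Y w))%:E) ->
  P.-integrable [set: T] (fun w => (expR (b * Y w))%:E) ->
  P.-integrable [set: T] (fun w => (Y w * expR (a * Y w))%:E) ->
  (b - a) * ((\int[P]_w (Y w * expR (a * Y w)))%R /
             (\int[P]_w expR (a * Y w))%R) <=
  ln (\int[P]_w expR (b * Y w))%R - ln (\int[P]_w expR (a * Y w))%R.
Proof.
move=> intY inta intb intYa.
have ma := mgf_gt0 inta intY; have mb := mgf_gt0 intb intY.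
rewrite -ln_div ?posrE//.
set c := (_ - _) * _.
rewrite -(expRK c) ler_ln ?posrE ?expR_gt0 ?divr_gt0// ler_pdivlMr//.
apply: le_trans (mgf_tangent c inta intb intYa).
rewrite ler_pM2l ?expR_gt0// /c le_eqVlt; apply/orP; left; apply/eqP.
by field; rewrite gt_eqF.
Qed.

(* [chernoff] only covers a positive exponent. *)
Lemma chernoff_two_sided {d} {T : measurableType d} {R : realType}
    (P : probability T R) (Y : {RV P >-> R}) (a c : R) :
  P.-integrable [set: T] (fun w => (expR (a * Y w))%:E) ->
  (P [set w | (c <= a * Y w)%R] <=
   ((\int[P]_w expR (a * Y w))%R * expR (- c))%:E)%E.
Proof.
(* The sign of [a] is absorbed into the variable [X], used with exponent 1. *)
move=> inta; pose X : {RV P >-> R} := cst a * Y.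
have := chernoff X c (ltr01 : (0 < 1 :> R)); rewrite mul1r => /le_trans; apply.
rewrite EFinM lee_wpmul2r ?lee_fin ?expR_ge0//.
rewrite fineK; last exact: integrable_fin_num.
rewrite /mmt_gen_fun unlock le_eqVlt; apply/orP; left; apply/eqP.
by apply: eq_integral => w _; rewrite /= mulr1.
Qed.

(** Taking [e] to be -1 or 1 serves the left or the right tail. The last hypothesis bounds the slope
    of s -> ln m(e s) by [p + k * s], which is integrated from the value 0 at s = 0. *)
Lemma mgf_le_quadratic {d} {T : measurableType d} {R : realType}
    (P : probability T R) (Y : T -> R) (e p k x : R) :
  0 <= x ->
  P.-integrable [set: T] (EFin \o Y) ->
  (forall s, 0 <= s <= x ->
    P.-integrable [set: T] (fun w => (expR (e * s * Y w))%:E)) ->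
  (forall s, 0 <= s <= x ->
    P.-integrable [set: T] (fun w => (Y w * expR (e * s * Y w))%:E)) ->
  (forall s, 0 <= s <= x ->
    e * (\int[P]_w (Y w * expR (e * s * Y w)))%R <=
    (p + k * s) * (\int[P]_w expR (e * s * Y w))%R) ->
  (\int[P]_w expR (e * x * Y w))%R <= expR (p * x + k * x ^+ 2 / 2).
Proof.
move=> x0 intY intm intD bnd.
have m_gt0 s : 0 <= s <= x -> 0 < (\int[P]_w expR (e * s * Y w))%R.
  by move=> sx; apply: mgf_gt0 => //; apply: intm.
pose f s := ln (\int[P]_w expR (e * s * Y w))%R.
have f0 : f 0 = 0.
  rewrite /f mulr0; under eq_Rintegral do rewrite mul0r expR0.
  rewrite Rintegral_cst// mul1r [fine _](congr1 fine (probability_setT P)).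
  exact: ln1.
rewrite -[leLHS]lnK ?posrE ?m_gt0 ?x0 ?lexx// ler_expR -[leLHS]subr0 -f0.
apply: (riemann_sum_bound f) => // a b a0 ab bx.
have ax : 0 <= a <= x by rewrite a0 (le_trans ab).
have bx' : 0 <= b <= x by rewrite bx (le_trans a0).
(* The supporting line at the right endpoint [b], read at [a], bounds [f b - f a] from above. *)
have := ln_mgf_tangent intY (intm _ bx') (intm _ ax) (intD _ bx').
rewrite -/(f a) -/(f b) -mulrBr.
set D := Rintegral _ _ _; set m := Rintegral _ _ _ => H.
have : e * (D / m) <= p + k * b.
  by rewrite mulrA ler_pdivrMr ?m_gt0//; apply: bnd.
move=> /(ler_wpM2l (_ : 0 <= b - a)); rewrite subr_ge0 => /(_ ab).
apply: le_trans; rewrite -lerN2 opprB; apply: le_trans H.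
by rewrite le_eqVlt; apply/orP; left; apply/eqP; ring.
Qed.

(** * Size bias and bounds on the moment generating function *)

Lemma size_biased_expR {d d'} {T : measurableType d} {T' : measurableType d'}
    {R : realType} {P : probability T R} {Y : {RV P >-> R}}
    {P' : probability T' R} {Ys : {RV P' >-> R}} {mu a : R} :
  size_biased Y Ys -> ('E_P[Y] = mu%:E)%E ->
  P.-integrable [set: T] (fun w => (Y w * expR (a * Y w))%:E) ->
  P'.-integrable [set: T'] (fun w => (expR (a * Ys w))%:E) ->
  (\int[P]_w (Y w * expR (a * Y w)))%R = mu * (\int[P']_w expR (a * Ys w))%R.
Proof.
move=> sb EY intY intYs.
have mexp : measurable_fun [set: R] (fun x : R => expR (a * x)).
  by apply: measurableT_comp => //; apply: measurable_funM.
have := sb _ mexp intY intYs.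
rewrite EY unlock /Rintegral => ->.
by rewrite fineM//; apply: integrable_fin_num.
Qed.

Lemma measurable_fun_expR_scale {d} {T : measurableType d} {R : realType}
    (P : probability T R) (Y : {RV P >-> R}) (a : R) :
  measurable_fun [set: T] (fun w => expR (a * Y w)).
Proof.
by apply: measurableT_comp => //; apply: measurable_funM.
Qed.

Lemma ae_ge0_expectation_integrable {d} {T : measurableType d} {R : realType}
    (P : probability T R) (Y : {RV P >-> R}) :
  {ae P, forall w, 0 <= Y w} -> ('E_P[Y] < +oo)%E ->
  P.-integrable [set: T] (EFin \o Y).
Proof.
move=> Y0 EY; apply/integrableP; split; first exact/measurable_EFinP.
apply: le_lt_trans EY; rewrite unlock le_eqVlt; apply/orP; left; apply/eqP.
apply: ae_eq_integral => //.
- by apply: measurableT_comp => //; exact/measurable_EFinP.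
- exact/measurable_EFinP.
- by apply: filterS Y0 => w /= Y0 _; rewrite ger0_norm.
Qed.

(** After factoring out e^(-sY), e^u >= 1 + u with u = -s (Ys - Y) >= -C s gives E e^(-s Ys) >= (1 -
    C s) E e^(-s Y). *)
Lemma size_biased_mgf_left {d} {T : measurableType d} {R : realType}
    (P : probability T R) (Y Ys : {RV P >-> R}) (mu C x : R) :
  {ae P, forall w, 0 <= Y w} -> 0 < mu -> ('E_P[Y] = mu%:E)%E ->
  size_biased Y Ys -> {ae P, forall w, `|Ys w - Y w| <= C} ->
  {ae P, forall w, Y w <= Ys w} -> 0 <= x ->
  P.-integrable [set: T] (fun w => (expR (- x * Y w))%:E) /\
  (\int[P]_w expR (- x * Y w))%R <= expR (- mu * x + mu * C * x ^+ 2 / 2).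
Proof.
move=> Y0 mu0 EY sb close YYs x0.
have intY : P.-integrable [set: T] (EFin \o Y).
  by apply: ae_ge0_expectation_integrable => //; rewrite EY ltry.
have int_exp (Z : {RV P >-> R}) s : {ae P, forall w, 0 <= Z w} -> 0 <= s ->
    P.-integrable [set: T] (fun w => (expR (- s * Z w))%:E).
  move=> Z0 s0; apply: (ae_le_integrable _ _ (cst 1)) => //.
  - exact: measurable_fun_expR_scale.
  - apply: filterS Z0 => w Z0.
    by rewrite /= normr1 ger0_norm ?expR_ge0// expR_le1 mulNr oppr_le0 mulr_ge0.
  - exact: finite_measure_integrable_cst.
have Ys0 : {ae P, forall w, 0 <= Ys w}.
  by apply: filterS2 Y0 YYs => w; exact: le_trans.
have intD s : 0 <= s ->
    P.-integrable [set: T] (fun w => (Y w * expR (- s * Y w))%:E).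
  move=> s0; apply: (ae_le_integrable _ _ Y) => //.
  - by apply: measurable_funM => //; exact: measurable_fun_expR_scale.
  - apply: filterS Y0 => w Y0.
    rewrite normrM ler_piMr// ger0_norm ?expR_ge0// expR_le1.
    by rewrite mulNr oppr_le0 mulr_ge0.
split; first exact: int_exp.
rewrite -(mulN1r x); apply: mgf_le_quadratic => // s /andP[s0 _]; rewrite ?mulN1r.
- exact: int_exp.
- exact: intD.
rewrite (size_biased_expR sb EY (intD _ s0) (int_exp _ _ Ys0 s0)) -lerN2 opprK.
have -> : - ((- mu + mu * C * s) * (\int[P]_w expR (- s * Y w))%R) =
  mu * ((1 - C * s) * (\int[P]_w expR (- s * Y w))%R) by ring.
rewrite ler_pM2l// -RintegralZl//; last exact: int_exp.
apply: ae_le_Rintegral; last 1 first.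
- apply: filterS2 YYs close => w YYs close.
  have -> : expR (- s * Ys w) = expR (- s * Y w) * expR (- s * (Ys w - Y w)).
    by rewrite -expRD; congr expR; ring.
  rewrite mulrC ler_pM2l ?expR_gt0// (le_trans _ (expR_ge1Dx _))//.
  rewrite lerD2l mulNr lerN2 mulrC ler_wpM2r//.
  by rewrite (le_trans _ close)// ler_norm.
- exact: (integrableZl measurableT (1 - C * s) (int_exp Y s Y0 s0)).
- exact: int_exp.
Qed.

(** The ratio (1 + C s / 2) / (1 - C s / 2) equals 1 + C s / (1 - C s / 2); freezing the last
    denominator at s = x makes the slope bound affine in s, as [mgf_le_quadratic] requires. *)
Lemma size_biased_mgf_right {d} {T : measurableType d} {R : realType}
    (P : probability T R) (Y Ys : {RV P >-> R}) (mu C x : R) :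
  {ae P, forall w, 0 <= Y w} -> 0 < mu -> 0 < C -> ('E_P[Y] = mu%:E)%E ->
  size_biased Y Ys -> {ae P, forall w, `|Ys w - Y w| <= C} ->
  ('M_P Y (2 / C) < +oo)%E -> 0 <= x < 2 / C ->
  P.-integrable [set: T] (fun w => (expR (x * Y w))%:E) /\
  (\int[P]_w expR (x * Y w))%R <=
    expR (mu * x + mu * C / (1 - C * x / 2) * x ^+ 2 / 2).
Proof.
move=> Y0 mu0 C0 EY sb close Mfin /andP[x0 xC].
have intY : P.-integrable [set: T] (EFin \o Y).
  by apply: ae_ge0_expectation_integrable => //; rewrite EY ltry.
have intM : P.-integrable [set: T] (fun w => (expR (2 / C * Y w))%:E).
  apply/integrableP; split.
    exact/measurable_EFinP/measurable_fun_expR_scale.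
  apply: le_lt_trans Mfin; rewrite /mmt_gen_fun unlock.
  rewrite le_eqVlt; apply/orP; left; apply/eqP; apply: eq_integral => w _ /=.
  by rewrite ger0_norm ?expR_ge0// mulrC.
have intZM k : P.-integrable [set: T] (fun w => (k * expR (2 / C * Y w))%:E).
  exact: (integrableZl measurableT k intM).
have int_exp s : 0 <= s <= x ->
    P.-integrable [set: T] (fun w => (expR (s * Y w))%:E).
  move=> /andP[s0 sx]; apply: ae_le_integrable intM.
  - exact: measurable_fun_expR_scale.
  - apply: filterS Y0 => w Y0.
    rewrite !ger0_norm ?expR_ge0// ler_expR ler_wpM2r//.
    by rewrite (le_trans sx)// ltW.
have intYs s : 0 <= s <= x ->
    P.-integrable [set: T] (fun w => (expR (s * Ys w))%:E).
  move=> sx; have /andP[s0 _] := sx.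
  apply: (ae_le_integrable _ _ _ _ _
    (integrableZl measurableT (expR (s * C)) (int_exp s sx))).
  - exact: measurable_fun_expR_scale.
  - apply: filterS close => w close.
    rewrite !ger0_norm ?mulr_ge0 ?expR_ge0// -expRD ler_expR -mulrDr.
    rewrite ler_wpM2l// -lerBlDr.
    by rewrite (le_trans _ close)// ler_norm.
have intD s : 0 <= s <= x ->
    P.-integrable [set: T] (fun w => (Y w * expR (s * Y w))%:E).
  (* The gap r = 2 / C - s is positive because x < 2 / C, and r Y <= e^(r Y) lets the exponential
     absorb the factor Y. *)
  move=> /andP[s0 sx]; have sC : 0 < 2 / C - s by rewrite subr_gt0 (le_lt_trans sx).
  apply: ae_le_integrable (intZM (2 / C - s)^-1).
  - by apply: measurable_funM => //; exact: measurable_fun_expR_scale.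
  - apply: filterS Y0 => w Y0.
    rewrite !ger0_norm ?mulr_ge0 ?expR_ge0 ?invr_ge0 ?(ltW sC)//.
    rewrite ler_pdivlMl//.
    have -> : 2 / C * Y w = (2 / C - s) * Y w + s * Y w by ring.
    rewrite expRD mulrA ler_pM2r ?expR_gt0//.
    by rewrite (le_trans _ (expR_ge1Dx _))// lerDr.
have q0 s : 0 <= s <= x -> 0 < 1 - C * s / 2.
  move=> /andP[_ sx]; have := le_lt_trans sx xC; rewrite ltr_pdivlMr//; lra.
split; first by apply: int_exp; rewrite x0 lexx.
have -> : (\int[P]_w expR (x * Y w))%R = (\int[P]_w expR (1 * x * Y w))%R.
  by rewrite mul1r.
apply: mgf_le_quadratic => // s sx; rewrite ?mul1r.
- exact: int_exp.
- exact: intD.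
have /andP[s0 sx'] := sx.
rewrite (size_biased_expR sb EY (intD _ sx) (intYs _ sx)).
set m := (\int[P]_w expR (s * Y w))%R; set n := (\int[P]_w expR (s * Ys w))%R.
have m0 : 0 <= m by apply: Rintegral_ge0 => w _; exact: expR_ge0.
(* Pointwise, e^(s (Ys - Y)) <= e^(C s), to which [expR_pade_le] applies. *)
have nm : (1 - C * s / 2) * n <= (1 + C * s / 2) * m.
  rewrite -!RintegralZl//; [|exact: int_exp|exact: intYs].
  apply: ae_le_Rintegral.
  - exact: (integrableZl measurableT (1 - C * s / 2) (intYs s sx)).
  - exact: (integrableZl measurableT (1 + C * s / 2) (int_exp s sx)).
  apply: filterS close => w close.
  have -> : expR (s * Ys w) = expR (s * Y w) * expR (s * (Ys w - Y w)).
    by rewrite -expRD; congr expR; ring.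
  rewrite mulrCA [leRHS]mulrC ler_pM2l ?expR_gt0//.
  have Cs0 : 0 <= C * s by exact: mulr_ge0 (ltW C0) s0.
  rewrite mulrC; apply: le_trans (expR_pade_le (C * s) Cs0).
  rewrite ler_pM2r ?q0// ler_expR mulrC ler_wpM2r//.
  by rewrite (le_trans _ close)// ler_norm.
have -> : (mu + mu * C / (1 - C * x / 2) * s) * m =
    mu * ((1 + C * s / (1 - C * x / 2)) * m) by ring.
rewrite ler_pM2l//.
have qs := q0 s sx.
apply: (@le_trans _ _ ((1 + C * s / (1 - C * s / 2)) * m)).
  rewrite -(ler_pM2l qs) (le_trans nm)// le_eqVlt; apply/orP; left; apply/eqP.
  by field; rewrite gt_eqF//; lra.
rewrite ler_wpM2r// lerD2l ler_wpM2l ?mulr_ge0 ?(ltW C0)//.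
rewrite lef_pV2 ?posrE ?q0 ?x0 ?lexx//.
by rewrite lerD2l lerN2 ler_pM2r// ler_pM2l.
Qed.

(** * Choice of the exponent and the two tail bounds *)

Theorem theorem1p1 (d : measure_display) (T : measurableType d) (R : realType)
    (P : probability T R) (Y Ys : {RV P >-> R}) (mu sigma C : R)
    (Y_ge0 : {ae P, forall w, 0 <= Y w})
    (mu_gt0 : 0 < mu) (sigma_gt0 : 0 < sigma) (C_gt0 : 0 < C)
    (Y_mean : ('E_P[Y] = mu%:E)%E)
    (Y_variance : ('V_P[Y] = (sigma ^+ 2)%:E)%E)
    (Ys_size_biased : @size_biased d d T T R P Y P Ys)
    (Ys_close : {ae P, forall w, `|Ys w - Y w| <= C}) :
  let A := C * mu / sigma ^+ 2 in
  let B := C / (2 * sigma) in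
  ({ae P, forall w, Y w <= Ys w} ->
     forall t : R, 0 < t ->
       (P [set w | ((Y w - mu) / sigma <= - t)%R]
          <= (expR (- (t ^+ 2 / (2 * A)))%R)%:E)%E)
  /\
  (('M_P Y (2 / C) < +oo)%E ->
     forall t : R, 0 < t ->
       (P [set w | (t <= (Y w - mu) / sigma)%R]
          <= (expR (- (t ^+ 2 / (2 * (A + B * t))))%R)%:E)%E).
Proof.
move=> A B.
have A0 : 0 < A by rewrite divr_gt0 ?mulr_gt0 ?exprn_gt0.
have B0 : 0 < B by rewrite divr_gt0 ?mulr_gt0.
have [s0 C0 m0] : [/\ sigma != 0, C != 0 & mu != 0] by rewrite !gt_eqF.
split=> [YYs|Mfin] t t0.
(* This [x] minimises the Chernoff exponent - t sigma x + C mu x^2 / 2. *)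
- pose x := t * sigma / (C * mu).
  have x0 : 0 < x by rewrite divr_gt0 ?mulr_gt0.
  have [intx mx] := size_biased_mgf_left P Y Ys mu C x Y_ge0 mu_gt0 Y_mean
    Ys_size_biased Ys_close YYs (ltW x0).
  have -> : [set w | ((Y w - mu) / sigma <= - t)%R] =
      [set w | (- x * (mu - t * sigma) <= - x * Y w)%R].
    apply: eq_set => w.
    by rewrite ler_pdivrMr// !mulNr lerN2 ler_pM2l// lerBlDl.
  apply: le_trans (chernoff_two_sided P Y _ _ intx) _.
  rewrite lee_fin -ler_pdivlMr ?expR_gt0// -expRB (le_trans mx)// ler_expR.
  rewrite le_eqVlt; apply/orP; left; apply/eqP; rewrite /A /x.
  by field; rewrite s0 C0 m0.
(* With y = sigma x and q = 1 - C x / 2 = 1 - B y, the Chernoff exponent is - t y + A y^2 / (2 q).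
   For q held fixed its minimiser is y = t q / A; solving this together with q = 1 - B y gives [x],
   and the exponent becomes - t y / 2. *)
- pose x := t / (A + B * t) / sigma.
  have AB0 : 0 < A + B * t by rewrite addr_gt0// mulr_gt0.
  have x0 : 0 < x by rewrite !divr_gt0.
  have qE : 1 - C * x / 2 = A / (A + B * t).
    rewrite /x; have -> : C = 2 * sigma * B by rewrite /B; field; rewrite s0.
    by field; rewrite s0 gt_eqF.
  have xC : 0 <= x < 2 / C.
    rewrite ltW//= ltr_pdivlMr//.
    have : 0 < 1 - C * x / 2 by rewrite qE divr_gt0.
    lra.
  have [intx mx] := size_biased_mgf_right P Y Ys mu C x Y_ge0 mu_gt0 C_gt0 Y_mean
    Ys_size_biased Ys_close Mfin xC.
  have -> : [set w | (t <= (Y w - mu) / sigma)%R] =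
      [set w | (x * (mu + t * sigma) <= x * Y w)%R].
    by apply: eq_set => w; rewrite ler_pdivlMr// ler_pM2l// lerBrDl.
  apply: le_trans (chernoff_two_sided P Y _ _ intx) _.
  rewrite lee_fin -ler_pdivlMr ?expR_gt0// -expRB (le_trans mx)// ler_expR.
  rewrite qE le_eqVlt; apply/orP; left; apply/eqP; rewrite /x.
  have -> : mu * C = A * sigma ^+ 2 by rewrite /A; field.
  by field; rewrite s0 !gt_eqF.
Qed.
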